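(* Let $\alpha\geq 1$ and $C>0$ be real numbers. For every triple of positive integers $k,\ell,r$ with $k\geq 3$ and $r\geq 3$, there exists a positive integer $N$ (depending on $k,\ell,r$ and on the constants $C,\alpha$) such that for all positive integers $n_1\leq n_2\leq\cdots\leq n_r$ with $n_r\leq C n_1^{\alpha}$ and $n_1\geq N$: (i) if $k<r$, then $rx_{k,\ell}(K_{n_1,n_2,\dots,n_r})=k$; (ii) if $k\geq r$ and $\ell\leq \dfrac{\binom{r}{2}\lceil k/r\rceil^{2}}{\lfloor k/r\rfloor}$, then $rx_{k,\ell}(K_{n_1,n_2,\dots,n_r})\in\{k,k+1\}$; (iii) if $k\geq r$ and $\ell> \dfrac{\binom{r}{2}\lceil k/r\rceil^{2}}{\lfloor k/r\rfloor}$, then $rx_{k,\ell}(K_{n_1,n_2,\dots,n_r})=k+1$. Moreover, when $k=r=3$ and $\ell\leq 3$ (where $3=\binom{r}{2}\lceil k/r\rceil^{2}/\lfloor k/r\rfloor$), there exists a positive integer $N$ (depending on $\ell$ and on $C,\alpha$) such that $rx_{3,\ell}(K_{n_1,n_2,n_3})=3$ for all positive integers $n_1\leq n_2\leq n_3$ with $n_3\leq C n_1^{\alpha}$ and $n_1\geq N$.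
   Context: All graphs are undirected, finite and simple. $K_{n_1,\dots,n_r}$ is the complete multipartite graph with $r$ vertex classes of sizes $n_1,\dots,n_r$. An edge-coloring of a graph $G$ with $t$ colors is any map $c:E(G)\to\{1,\dots,t\}$ (adjacent edges may receive the same color). A tree $T$ that is a subgraph of $G$ is a rainbow tree if no two edges of $T$ have the same color. For $S\subseteq V(G)$, an $S$-tree is a tree in $G$ containing all vertices of $S$, and a rainbow $S$-tree is an $S$-tree that is a rainbow tree. Rainbow $S$-trees $T_1,\dots,T_\ell$ are internally disjoint if $E(T_i)\cap E(T_j)=\emptyset$ and $V(T_i)\cap V(T_j)=S$ for all $1\le i,j\le \ell$ with $i\neq j$. The $(k,\ell)$-rainbow index $rx_{k,\ell}(G)$, defined for positive integers $k,\ell$, is the minimum number of colors needed in an edge-coloring of $G$ such that for every set $S$ of $k$ vertices of $G$ there exist $\ell$ internally disjoint rainbow $S$-trees. *)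

(* Defs.v *)
From HB Require Import structures.
From mathcomp Require Import all_boot all_order all_algebra.

Set Implicit Arguments.
Unset Strict Implicit.
Unset Printing Implicit Defensive.

Import Order.TTheory GRing.Theory Num.Theory.

Record sgraph := SGraph {
  vertex :> finType;
  adj : rel vertex;
  adj_sym : symmetric adj;
  adj_irrefl : irreflexive adj
}.

Definition edges (G : sgraph) : {set {set G}} :=
  [set [set u; v] | u in predT, v in adj u].

Record subgraph (G : sgraph) := Subgraph {
  sverts : {set G};
  sedges : {set {set G}};
  sedges_sub : sedges \subset edges G;
  sedges_verts : {in sedges, forall e : {set G}, e \subset sverts}
}.

(* Irreflexive, because [set u; u] is a singleton and hence never an edge. *)
Definition sadj (G : sgraph) (H : subgraph G) : rel G :=
  [rel u v | [set u; v] \in sedges H].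

Definition connected (G : sgraph) (H : subgraph G) : Prop :=
  sverts H != set0 /\ {in sverts H &, forall u v, connect (sadj H) u v}.

(* The bound on the size excludes [:: u; v], which MathComp counts as a cycle
   of any symmetric relation joining u and v. *)
Definition acyclic (G : sgraph) (H : subgraph G) : Prop :=
  forall p : seq G, 2 < size p -> ~ ucycle (sadj H) p.

Definition is_tree (G : sgraph) (H : subgraph G) : Prop :=
  connected H /\ acyclic H.

(* Colorings are functions on all vertex sets; only their values on the edges
   of G matter. *)
Definition edge_coloring (G : sgraph) (t : nat) (c : {set G} -> nat) : Prop :=
  {in edges G, forall e : {set G}, 1 <= c e <= t}.

Definition rainbow_Stree (G : sgraph) (c : {set G} -> nat) (S : {set G})
    (T : subgraph G) : Prop :=
  [/\ is_tree T, S \subset sverts T & {in sedges T &, injective c}].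

Definition internally_disjoint (G : sgraph) (S : {set G}) (l : nat)
    (T : 'I_l -> subgraph G) : Prop :=
  forall i j : 'I_l, i != j ->
    sedges (T i) :&: sedges (T j) = set0 /\ sverts (T i) :&: sverts (T j) = S.

Definition rainbow_colorable (k l : nat) (G : sgraph) (t : nat) : Prop :=
  exists2 c : {set G} -> nat, edge_coloring t c &
    forall S : {set G}, #|S| = k ->
      exists T : 'I_l -> subgraph G,
        (forall i, rainbow_Stree c S (T i)) /\ internally_disjoint S T.

(* rx_{k,l}(G) = m.  A relation rather than a function, because a graph with
   too few internally disjoint trees has no suitable coloring at all; thus
   [is_rx k l G m] also asserts that the minimum exists. *)
Definition is_rx (k l : nat) (G : sgraph) (m : nat) : Prop :=
  rainbow_colorable k l G m /\ forall t, rainbow_colorable k l G t -> m <= t.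

Definition multipartite_adj (r : nat) (n : r.-tuple nat) :
    rel {i : 'I_r & 'I_(tnth n i)} :=
  [rel u v | tag u != tag v].

Fact multipartite_adj_sym (r : nat) (n : r.-tuple nat) :
  symmetric (@multipartite_adj r n).
Proof. by move=> u v; rewrite /multipartite_adj /= eq_sym. Qed.

Fact multipartite_adj_irrefl (r : nat) (n : r.-tuple nat) :
  irreflexive (@multipartite_adj r n).
Proof. by move=> u; rewrite /multipartite_adj /= eqxx. Qed.

Definition complete_multipartite (r : nat) (n : r.-tuple nat) : sgraph :=
  SGraph (multipartite_adj_sym (n := n)) (multipartite_adj_irrefl (n := n)).

Local Open Scope ring_scope.

Definition rx_threshold (k r : nat) : rat :=
  'C(r, 2)%:R * (Num.ceil (k%:R / r%:R : rat))%:~R ^+ 2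
    / (Num.floor (k%:R / r%:R : rat))%:~R.

(* Main.v *)
(** A random coloring with t colors of the pairs of vertices extends every
    pattern: for every small vertex set A, every map h from A to the colors and
    every vertex class V_i there is w in V_i outside A with c {w, x} = h x for
    all x in A.  The candidates w involve disjoint sets of pairs, so that a
    given pattern fails with probability exponentially small in n_1, whereas
    the number of patterns is polynomial in n_1.

    All upper bounds follow greedily from this property.  If S misses a class,
    a vertex w of that class with distinct colors towards S gives a rainbow
    star with k edges.  In general, two adjacent vertices u and v outside S
    carry a rainbow double star with k + 1 edges.  For k = r = 3 and
    S = {s_0, s_1, s_2} meeting all classes, the three trees are formed by the
    edge s_i s_(i+1) and a vertex w_i in the class of s_i, joined to the two
    other vertices of S.

    For the lower bounds, an S-tree with S inside one class has a vertex
    outside S and hence at least k edges.  If S is spread evenly over the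
    classes, an S-tree with at most k edges has at most one vertex w outside S;
    since w has no neighbor in its own class, at least floor(k/r) edges of the
    tree lie inside S, which spans at most binom(r,2) ceil(k/r)^2 edges. *)
Require Import Defs.
From mathcomp Require Import all_boot all_order all_algebra.
From mathcomp.classical Require Import unstable.
From mathcomp Require Import boolp reals exp.
From mathcomp Require Import zify.

Set Implicit Arguments.
Unset Strict Implicit.
Unset Printing Implicit Defensive.

Import Order.TTheory GRing.Theory Num.Theory.

(** * Counting failed patterns, and growth estimates *)

(* Recoloring c by h on f @: A loses only the t ^ #|A| possible old values. *)
Lemma card_agree (X E : finType) (t : nat) (P : pred {ffun E -> 'I_t})
    (A : {set X}) (f : X -> E) (h : X -> 'I_t) :
  {in A &, injective f} ->
  (forall c c' : {ffun E -> 'I_t},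
     (forall e, e \notin f @: A -> c e = c' e) -> P c -> P c') ->
  #|P| <= #|[pred c | P c && [forall x in A, c (f x) == h x]]| * t ^ #|A|.
Proof.
move=> injf locP.
pose ov (c : {ffun E -> 'I_t}) : {ffun E -> 'I_t} :=
  [ffun e => if [pick x in A | f x == e] is Some x then h x else c e].
pose rs (c : {ffun E -> 'I_t}) := [ffun j : 'I_#|A| => c (f (enum_val j))].
have inj : injective (fun c => (ov c, rs c)).
  move=> c c' [/ffunP eqo /ffunP eqr]; apply/ffunP => e.
  have := eqo e; rewrite !ffunE; case: pickP => // x /andP[xA /eqP <-] _.
  by have := eqr (enum_rank_in xA x); rewrite !ffunE enum_rankK_in.
rewrite -(card_imset P inj).
set Q := [pred c | _ && _].
have -> : #|Q| * t ^ #|A| = #|setX [set c in Q] [set: {ffun 'I_#|A| -> 'I_t}]|.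
  by rewrite cardsX cardsE cardsT card_ffun !card_ord.
apply/subset_leq_card/subsetP => _ /imsetP[c Pc ->].
rewrite !inE /= andbT; apply/andP; split.
  apply: locP Pc => e eA; rewrite ffunE; case: pickP => // x /andP[xA /eqP fx].
  by rewrite -fx imset_f in eA.
apply/forall_inP => x xA; rewrite ffunE; case: pickP => [y /andP[yA /eqP]|].
  by move/injf => ->.
by move/(_ x); rewrite xA eqxx.
Qed.

(** Each candidate [w] leaves at most a share 1 - 1/M of the colorings, where M = [t.+1 ^ q]: the
    elements [f w x] are fresh, so failures at other candidates say nothing about their colors. The
    resulting product bound is written with denominators cleared. *)
Lemma card_fail (X E : finType) (t : nat) (A : {set X}) (f : X -> X -> E)
    (h : X -> 'I_t.+1) (q : nat) (W : seq X) :
  uniq W -> #|A| <= q -> {in W, forall w, {in A &, injective (f w)}} ->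
  {in W &, forall w w', w != w' -> {in A &, forall x y, f w x != f w' y}} ->
  #|[pred c : {ffun E -> 'I_t.+1} |
      all (fun w => ~~ [forall x in A, c (f w x) == h x]) W]|
    * (t.+1 ^ q) ^ size W
  <= #|{: {ffun E -> 'I_t.+1}}| * (t.+1 ^ q).-1 ^ size W.
Proof.
elim: W => [|w W IH] /=.
  by rewrite !muln1 => _ _ _ _; apply: max_card.
move=> /andP[wW uW] Aq injW disW.
have sW x : x \in W -> x \in w :: W by rewrite inE orbC => ->.
have {IH} := IH uW Aq (fun x xW => injW x (sW x xW))
  (fun x y xW yW => disW x y (sW x xW) (sW y yW)).
set P := [pred c | all _ W] => IH.
have locP (c c' : {ffun E -> 'I_t.+1}) :
    (forall e, e \notin f w @: A -> c e = c' e) -> P c -> P c'.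
  move=> ecc /allP Pc; apply/allP => v vW; have := Pc v vW.
  apply: contra => /forall_inP ag; apply/forall_inP => x xA.
  rewrite ecc ?ag //; apply/negP => /imsetP[y yA] /eqP.
  apply/negP/disW => //; first exact: sW.
    exact: mem_head.
  by apply: contraNneq wW => <-.
have := @card_agree X E t.+1 P A (f w) h (injW w (mem_head _ _)) locP.
set Q := [pred c | _ && _] => leQ.
rewrite (eq_card (B := [predD P & Q])); last first.
  by move=> c; rewrite !inE /=; case: [forall _ in _, _]; case: (all _ _).
have cPQ : #|P| = #|Q| + #|[predD P & Q]|.
  rewrite -(cardID Q P); congr (_ + _); apply: eq_card => c.
  by rewrite !inE /=; case: [forall _ in _, _]; case: (all _ _).
have leq' : t.+1 ^ #|A| <= t.+1 ^ q by rewrite leq_pexp2l.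
have h1 : #|P| <= #|Q| * t.+1 ^ q by apply: leq_trans leQ _; rewrite leq_mul2l leq' orbT.
have q0 : 0 < t.+1 ^ q by rewrite expn_gt0.
rewrite !expnS; set M := t.+1 ^ q in h1 q0 IH *.
(* Agreement at [w] takes at least a share 1/M of [P]. *)
have h2 : #|[predD P & Q]| * M <= #|P| * M.-1.
  by rewrite cPQ in h1 *; case: M h1 q0 {IH leq'} => //= M; nia.
rewrite mulnA; apply: leq_trans (leq_mul h2 (leqnn _)) _.
by rewrite mulnAC mulnCA [X in _ <= X]mulnC leq_mul2r IH orbT.
Qed.

(** Bernoulli's inequality weakened to s/Q <= (1 + 1/Q)^s, with denominators cleared. *)
Lemma bernoulli_nat (Q s : nat) : s * Q ^ s <= Q * Q.+1 ^ s.
Proof.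
elim: s => // s IH; rewrite !expnS.
have : Q ^ s <= Q.+1 ^ s by case: s {IH} => // s; rewrite leq_exp2r.
nia.
Qed.

Lemma exp_dominates_poly (Q D b e : nat) :
  exists N, forall n, N <= n -> D * n ^ b * Q ^ (n - e) < Q.+1 ^ (n - e).
Proof.
(* With d = b + 1 and s = (n - e) / d, the d-th power of Bernoulli's
   inequality gives (s / Q)^d <= (1 + 1/Q)^(s d), and s^d outgrows n^b. *)
pose d := b.+1; pose s0 := D * (2 * d + e) ^ b * Q ^ d.
exists (d * s0.+1 + e) => n le_n.
have d0 : 0 < d by [].
case: (posnP Q) => [-> | Q0].
  have n0 : 0 < n - e by rewrite subn_gt0; lia.
  by rewrite exp0n // muln0 exp1n.
have := divn_eq (n - e) d; have := ltn_pmod (n - e) d0.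
set s := (n - e) %/ d; set p := (n - e) %% d => lt_p def_n.
have lt_s : s0 < s by rewrite /s leq_divRL // mulnC; lia.
(* Here n - e < (s + 1) d <= 2 s d. The value of [s0] is chosen so that this gives D n^b Q^d <= s0
   s^b < s^d. *)
have le_ns : n <= s * (2 * d + e) by nia.
have main : D * n ^ b * Q ^ (s * d) < Q.+1 ^ (s * d).
  have Qd0 : 0 < Q ^ d by rewrite expn_gt0 Q0.
  have Qsd0 : 0 < Q ^ (s * d) by rewrite expn_gt0 Q0.
  have h1 : s ^ d * Q ^ (s * d) <= Q ^ d * Q.+1 ^ (s * d).
    by rewrite !expnM -!expnMn leq_exp2r // bernoulli_nat.
  rewrite -(ltn_pmul2l Qd0); apply: leq_trans h1.
  rewrite mulnA ltn_pmul2r //.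
  have h2 : n ^ b <= s ^ b * (2 * d + e) ^ b.
    by rewrite -expnMn; case: (b) => // b'; rewrite leq_exp2r.
  have sb0 : 0 < s ^ b by rewrite expn_gt0; apply/orP; left; lia.
  apply: (@leq_ltn_trans (s0 * s ^ b)).
    by rewrite /s0; nia.
  by rewrite /d expnS ltn_pmul2r.
rewrite def_n !expnD mulnA.
have Qp0 : 0 < Q ^ p by rewrite expn_gt0 Q0.
have : Q ^ p <= Q.+1 ^ p by case: (p) => // p'; rewrite leq_exp2r.
move: main Qp0; set x := D * _ * _; set y := Q.+1 ^ _; nia.
Qed.

(** * Existence of extensible colorings *)

(** The analogue for colorings of the extension axioms of random graphs. Pairs inside a class are
    colored too, so [h] is unrestricted on [A]; the type ['I_t.+1] keeps the palette nonempty. *)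
Definition extensible (r q t : nat) (T : finType) (V : 'I_r -> {set T})
    (c : {set T} -> 'I_t.+1) : Prop :=
  forall (A : {set T}) (h : T -> 'I_t.+1) (i : 'I_r), #|A| <= q ->
  exists w, [/\ w \in V i, w \notin A & {in A, forall x, c [set w; x] = h x}].

Lemma extension_coloring (t q r K a : nat) :
  exists N, forall (T : finType) (V : 'I_r -> {set T}) (n : nat),
    N <= n -> (forall i, n <= #|V i|) -> #|T| <= K * n ^ a ->
    exists c : {set T} -> 'I_t.+1, extensible q V c.
Proof.
(* At most [#|T| ^ q * t.+1 ^ q * r] patterns occur, whence the factor and the degree [a * q]; the
   final [q] accounts for the vertices of a class lost to [A]. *)
have [N domN] :=
  exp_dominates_poly (t.+1 ^ q).-1 (K ^ q * t.+1 ^ q * r) (a * q) q.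
exists (maxn N 1) => T V n; rewrite geq_max => /andP[le_Nn n0] le_nV le_T.
have {domN} := domN n le_Nn; rewrite prednK ?expn_gt0 //.
set m := n - q; set M := t.+1 ^ q; move=> dom.
(* A pattern is a list of q vertices, possibly with repetitions, together with
   their colors; a repeated vertex gets its first color. *)
pose I := (q.-tuple T * q.-tuple 'I_t.+1 * 'I_r)%type.
pose A (p : I) := [set x in p.1.1].
pose h (p : I) x := nth ord0 p.1.2 (index x p.1.1).
(* Keeping exactly [m] candidates gives all patterns the same failure bound. *)
pose W (p : I) := take m (enum (V p.2 :\: A p)).
pose bad (p : I) := [set c : {ffun {set T} -> 'I_t.+1} |
  all (fun w => ~~ [forall x in A p, c [set w; x] == h p x]) (W p)].
have cA p : #|A p| <= q.
  by rewrite cardsE (leq_trans (card_size _)) // size_tuple.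
have inW p w : w \in W p -> (w \in V p.2) && (w \notin A p).
  by move/mem_take; rewrite mem_enum inE andbC.
have sizeW p : size (W p) = m.
  apply: size_takel; rewrite -cardE cardsD /m.
  apply: leq_sub (le_nV _) (leq_trans _ (cA p)).
  by rewrite subset_leq_card // subsetIr.
have bad_small p :
    #|bad p| * M ^ m <= #|{: {ffun {set T} -> 'I_t.+1}}| * M.-1 ^ m.
  rewrite cardsE -{1 2}(sizeW p).
  apply: (@card_fail _ _ _ (A p) (fun w x => [set w; x]) (h p) q) => //.
  - by rewrite take_uniq ?enum_uniq.
  - move=> w /inW /andP[_ wA] x y xA yA /setP/(_ x); rewrite !inE eqxx orbT.
    by case: eqVneq xA => [->|_ _ /esym/eqP //]; rewrite (negPf wA).
  - move=> v w /inW /andP[_ vA] _ vw x y xA yA; apply/eqP => /setP/(_ v).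
    rewrite !inE eqxx (negPf vw) /= => /esym/eqP def_v.
    by rewrite def_v yA in vA.
have card_I : #|{: I}| <= K ^ q * t.+1 ^ q * r * n ^ (a * q).
  rewrite !card_prod !card_tuple !card_ord.
  have : #|T| ^ q <= (K * n ^ a) ^ q by case: (q) => // q'; rewrite leq_exp2r.
  rewrite expnMn -expnM => le_Tq.
  rewrite [leqRHS]mulnAC; apply: leq_mul => //.
  by rewrite [leqRHS]mulnAC; apply: leq_mul.
(* Union bound: were every coloring bad, the number of patterns times (1 - 1/M)^m would be at least
   1. *)
have [c cbad] : exists c, c \notin \bigcup_p bad p.
  apply/existsP; rewrite -negb_forall; apply/negP => /forallP all_bad.
  have le_tot : #|{: {ffun {set T} -> 'I_t.+1}}| <= \sum_p #|bad p|.
    apply: leq_trans (card_big_setU _ predT bad).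
    by apply/subset_leq_card/subsetP => c _; apply: all_bad.
  have tot0 : 0 < #|{: {ffun {set T} -> 'I_t.+1}}|.
    by rewrite card_ffun card_ord expn_gt0.
  have : #|{: {ffun {set T} -> 'I_t.+1}}| * M ^ m
         <= #|{: I}| * (#|{: {ffun {set T} -> 'I_t.+1}}| * M.-1 ^ m).
    have le2 : \sum_p #|bad p| * M ^ m
        <= \sum_(p : I) #|{: {ffun {set T} -> 'I_t.+1}}| * M.-1 ^ m.
      by apply: leq_sum => p _; apply: bad_small.
    rewrite sum_nat_const in le2; apply: leq_trans le2.
    by rewrite -big_distrl leq_mul2r le_tot orbT.
  rewrite mulnCA leq_pmul2l // leqNgt; apply/negP/negPn.
  by apply: leq_ltn_trans dom; rewrite leq_mul2r card_I orbT.
exists c => B g i cB.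
have [x0 x0V] : exists x, x \in V i.
  by apply/set0Pn; rewrite -card_gt0 (leq_trans n0).
(* Since [#|B| <= q], the truncation keeps all of [B]. Padding may add [x0] to [A p], and agreement
   there does no harm. *)
have szs : size (take q (enum B ++ nseq q x0)) == q.
  by rewrite size_takel // size_cat size_nseq leq_addl.
pose s : q.-tuple T := Tuple szs.
pose p : I := (s, map_tuple g s, i).
have sub : B \subset A p.
  apply/subsetP => x xB; rewrite inE; change (x \in take q (enum B ++ nseq q x0)).
  have := cB; rewrite leqNgt cardE take_cat => /negPf->.
  by rewrite mem_cat mem_enum xB.
move: cbad; rewrite (bigD1 p) //= inE negb_or => /andP[+ _].
rewrite inE => /allPn[w /inW/andP[wV wA]].
rewrite negbK => /forall_inP agr; exists w; split=> //.
  by apply: contra wA; apply: (subsetP sub).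
move=> x xB; have xA := subsetP sub x xB; rewrite (eqP (agr x xA)).
rewrite inE in xA.
by rewrite /h /= (nth_map x0) ?index_mem // nth_index.
Qed.

(** * Trees given by parent maps, and edge counts *)

Lemma eq_set2_cases (T : finType) (x y x' y' : T) :
  [set x; y] = [set x'; y'] -> x = x' /\ y = y' \/ x = y' /\ y = x'.
Proof.
move=> /setP e; move: (e x) (e y) (e x') (e y').
rewrite !inE !eqxx !orbT /=.
by move=> /esym/orP[]/eqP-> /esym/orP[]/eqP-> /orP[]/eqP ? /orP[]/eqP ?; subst; auto.
Qed.

Lemma in_edges (G : sgraph) (u v : G) : ([set u; v] \in edges G) = adj u v.
Proof.
apply/imset2P/idP => [[x y _ /= xy /eq_set2_cases[[-> ->]|[-> ->]]] // | uv].
  by rewrite adj_sym.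
by exists u v.
Qed.

(** The decrease of [d] along the parent map [p] serves twice: induction on [d] connects every
    vertex to the root, and a cycle would have a deepest vertex. *)
Lemma rooted_tree (G : sgraph) (V : {set G}) (root : G) (p : G -> G)
    (d : G -> nat) :
  root \in V ->
  (forall v, v \in V -> v != root -> [/\ p v \in V, adj v (p v) & d (p v) < d v]) ->
  exists T : subgraph G, [/\ is_tree T, sverts T = V &
    sedges T = [set [set v; p v] | v in V :\ root]].
Proof.
move=> rootV parent; pose E := [set [set v; p v] | v in V :\ root].
have subE : E \subset edges G.
  apply/subsetP => _ /imsetP[v + ->]; rewrite !inE => /andP[vr vV].
  by rewrite in_edges; have [] := parent v vV vr.
have vertE : {in E, forall e : {set G}, e \subset V}.
  move=> _ /imsetP[v + ->]; rewrite !inE => /andP[vr vV].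
  by have [pV _ _] := parent v vV vr; rewrite subUset !sub1set vV.
exists (Subgraph subE vertE); split=> //; split; first split.
- by apply/set0Pn; exists root.
- move=> u v uV vV; pose e := sadj (Subgraph subE vertE).
  have sym_e : connect_sym e.
    by apply: sym_connect_sym => x y; rewrite /e /sadj /= setUC.
  suff to_root : forall x, x \in V -> connect e x root.
    by apply: connect_trans (to_root u uV) _; rewrite sym_e to_root.
  move=> x; have [m] := ubnP (d x); elim: m x => // m IH x lt_dm xV.
  case: (eqVneq x root) => [->|xr]; first exact: connect0.
  have [pV _ lt_p] := parent x xV xr.
  apply: connect_trans (connect1 _) (IH (p x) _ pV); last by lia.
  by rewrite /e /sadj /=; apply/imsetP; exists x; rewrite ?inE ?xr.
move=> s size_s /andP[cyc uni].
have [x0 x0s] : exists x0, x0 \in s.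
  by case: s size_s {cyc uni} => // x s _; exists x; apply: mem_head.
(* Both cycle neighbors of a deepest vertex of the cycle equal its parent. *)
have [x xs max_x] := @arg_maxnP _ x0 (mem s) d x0s.
have up y : y \in s -> [set x; y] \in E -> y = p x.
  move=> ys /imsetP[v]; rewrite !inE => /andP[vr vV].
  case/eq_set2_cases => -[ev ey]; first by rewrite ey ev.
  have [_ _] := parent v vV vr; rewrite -ev -ey => lt_d.
  by have := max_x y ys; rewrite /= leqNgt lt_d.
have nx : next s x = p x by apply: up; rewrite ?mem_next //; exact: (next_cycle cyc xs).
have px : prev s x = p x.
  by apply: up; rewrite ?mem_prev // setUC; exact: (prev_cycle cyc xs).
(* Two steps along the cycle lead back to [x], which is impossible for three or more distinct
   vertices. *)
have loop2 : next s (next s x) = x by rewrite nx -px next_prev.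
case/rot_to: xs => i s' def_s.
have uni' : uniq (rot i s) by rewrite rot_uniq.
move: loop2; rewrite -(next_rot i uni) -[in next s x](next_rot i uni) def_s.
move: size_s uni'; rewrite -(size_rot i) def_s; case: s' {def_s} => [|y [|z s']] //= _.
rewrite !inE !negb_or eqxx => /and3P[/and3P[xy xz _] _ _].
by rewrite [y == x]eq_sym (negPf xy) eqxx => /esym/eqP; rewrite (negPf xz).
Qed.

(** Turns a bound on the edges of a rainbow tree, given by the number of colors, into a bound on its
    vertices. *)
Lemma connected_card (G : sgraph) (H : subgraph G) :
  connected H -> #|sverts H| <= #|sedges H|.+1.
Proof.
case=> /set0Pn[x xV] conn.
(* Grow A one vertex at a time, each new vertex bringing an edge to A. *)
suff grow m : m < #|sverts H| -> exists A : {set G},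
    [/\ x \in A, A \subset sverts H, #|A| = m.+1 &
        m <= #|[set e in sedges H | e \subset A]|].
  have c0 : 0 < #|sverts H| by apply/card_gt0P; exists x.
  have [|A [_ _ _ leA]] := grow #|sverts H|.-1; first by rewrite prednK.
  rewrite -(prednK c0) ltnS; apply: leq_trans leA _.
  by apply/subset_leq_card/subsetP => e; rewrite inE => /andP[].
elim: m => [|m IH] lt_m.
  by exists [set x]; rewrite set11 sub1set xV cards1.
have [A [xA AV cA leA]] := IH (ltnW lt_m).
have [y yV yA] : exists2 y, y \in sverts H & y \notin A.
  apply/subsetPn; apply: contraL lt_m => /subset_leq_card.
  by rewrite cA -leqNgt.
have /connectP[s path_s last_s] := conn x y xV yV.
(* The first edge leaving [A] on the path from [x] to [y]. *)
have [u [v [uA vA uv]]] : exists u v, [/\ u \in A, v \notin A & sadj H u v].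
  elim: s (x) xA path_s last_s => [|v s IHs] u uA /=.
    by move=> _ def_y; rewrite def_y uA in yA.
  case/andP=> uv; case: (boolP (v \in A)) => [vA|]; last by exists u, v.
  exact: IHs.
have vV : v \in sverts H.
  by apply: (subsetP (sedges_verts uv)); rewrite !inE eqxx orbT.
exists (v |: A); split.
- by rewrite inE xA orbT.
- by rewrite subUset sub1set vV.
- by rewrite cardsU1 vA cA.
apply: leq_trans (_ : #|[set u; v] |: [set e in sedges H | e \subset A]| <= _).
  rewrite cardsU1 inE subUset !sub1set (negPf vA) !andbF.
  by rewrite add1n ltnS.
apply/subset_leq_card/subsetP => e; rewrite !inE => /orP[/eqP->|/andP[-> eA]] /=.
  by rewrite [_ \in _]uv subUset !sub1set !inE eqxx uA orbT.
by apply: subset_trans eA _; apply: subsetUr.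
Qed.

(** Edges are indexed by their child end, so being rainbow becomes injectivity on the vertices other
    than the root. *)
Lemma rooted_rainbow (G : sgraph) (c : {set G} -> nat) (S V : {set G})
    (root : G) (p : G -> G) (d : G -> nat) :
  root \in V -> S \subset V ->
  (forall v, v \in V -> v != root -> [/\ p v \in V, adj v (p v) & d (p v) < d v]) ->
  {in V :\ root &, injective (fun v => c [set v; p v])} ->
  exists T : subgraph G, [/\ rainbow_Stree c S T, sverts T = V &
    sedges T = [set [set v; p v] | v in V :\ root]].
Proof.
move=> rootV SV parent inj.
have [T [treeT vertT edgeT]] := rooted_tree rootV parent.
exists T; split=> //; split; rewrite ?vertT // edgeT.
by move=> _ _ /imsetP[x xV ->] /imsetP[y yV ->] /(inj x y xV yV) ->.
Qed.

(** * Rainbow stars and double stars *)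

(** The star with center [w] and leaves [S]. That no edge lies inside [S] later yields
    edge-disjointness from vertex-disjointness outside [S]. *)
Lemma star_rainbow (G : sgraph) (c : {set G} -> nat) (S : {set G}) (w : G) :
  w \notin S -> {in S, forall s, adj w s} ->
  {in S &, injective (fun s => c [set w; s])} ->
  exists T : subgraph G, [/\ rainbow_Stree c S T, sverts T = w |: S &
    {in sedges T, forall e : {set G}, ~~ (e \subset S)}].
Proof.
move=> wS adjw inj.
have wVS : (w |: S) :\ w = S by rewrite setU1K.
have [T [rT vT eT]] : exists T : subgraph G, [/\ rainbow_Stree c S T,
    sverts T = w |: S & sedges T = [set [set v; w] | v in (w |: S) :\ w]].
  apply: (@rooted_rainbow _ _ _ _ _ _ (fun v => v != w : nat)).
  - exact: setU11.
  - exact: subsetUr.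
  - move=> v; rewrite !inE => /orP[/eqP->|vS vw]; first by rewrite eqxx.
    by rewrite eqxx /= vw adj_sym adjw.
  - rewrite wVS => x y xS yS; rewrite ![[set _; w]]setUC; exact: inj.
exists T; split=> //; rewrite eT => _ /imsetP[v _ ->].
by rewrite subUset !sub1set (negPf wS) andbF.
Qed.

Lemma double_star_rainbow (G : sgraph) (c : {set G} -> nat) (S : {set G})
    (u v : G) (p := fun s => if adj u s then u else v) :
  u \notin S -> v \notin S -> adj u v -> {in S, forall s, ~~ adj u s -> adj v s} ->
  {in S &, injective (fun s => c [set p s; s])} ->
  {in S, forall s, c [set p s; s] <> c [set u; v]} ->
  exists T : subgraph G, [/\ rainbow_Stree c S T, sverts T = u |: (v |: S) &
    {in sedges T, forall e : {set G}, ~~ (e \subset S)}].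
Proof.
move=> uS vS uv adjv inj new.
have neq_uv : u != v by apply: contraTneq uv => ->; rewrite adj_irrefl.
have pv : p v = u by rewrite /p uv.
have uVS : (u |: (v |: S)) :\ u = v |: S.
  by rewrite setU1K // !inE negb_or neq_uv.
have [T [rT vT eT]] : exists T : subgraph G, [/\ rainbow_Stree c S T,
    sverts T = u |: (v |: S) &
    sedges T = [set [set s; p s] | s in (u |: (v |: S)) :\ u]].
  (* Depth 0 at [u], 1 at [v] and 2 on [S], whichever center a vertex of [S] hangs from. *)
  apply: (@rooted_rainbow _ _ _ _ _ _
    (fun s => (s != u) + (s \in S))).
  - exact: setU11.
  - by rewrite !subsetU ?subxx ?orbT.
  - move=> s; rewrite !inE; case: eqVneq => //= su /orP[/eqP-> _|sS _].
      by rewrite pv !eqxx /= adj_sym uv (negPf uS).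
    rewrite sS /p; case: ifP => [us|/negbT us].
      by rewrite eqxx adj_sym us (negPf uS).
    by rewrite eqxx orbT adj_sym adjv // (negPf vS) eq_sym neq_uv.
  - rewrite uVS => x y; rewrite !inE.
    move=> /orP[/eqP->|xS] /orP[/eqP->|yS] //.
    + by rewrite pv setUC [[set y; _]]setUC => /esym/new.
    + by rewrite pv setUC [[set v; _]]setUC => /new.
    + by rewrite setUC [[set y; _]]setUC => /inj ->.
exists T; split=> //; rewrite eT => _ /imsetP[s _ ->].
by rewrite subUset !sub1set /p; case: ifP; rewrite ?(negPf uS) ?(negPf vS) andbF.
Qed.

(** * Greedy choice of internally disjoint trees *)

(** [F] collects the vertices outside [S] used by the earlier trees. Each tree adds at most [b], so
    [F] never exceeds [b * l]. *)
Lemma disjoint_family (G : sgraph) (c : {set G} -> nat) (S : {set G})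
    (b l : nat) :
  (forall F : {set G}, [disjoint F & S] -> #|F| <= b * l ->
     exists T : subgraph G, [/\ rainbow_Stree c S T, #|sverts T :\: S| <= b,
       [disjoint sverts T & F] &
       {in sedges T, forall e : {set G}, ~~ (e \subset S)}]) ->
  exists T : 'I_l -> subgraph G,
    (forall i, rainbow_Stree c S (T i)) /\ internally_disjoint S T.
Proof.
move=> step.
suff [f [goodf disjf]] : exists f : nat -> subgraph G,
    (forall i, i < l -> [/\ rainbow_Stree c S (f i), #|sverts (f i) :\: S| <= b &
       {in sedges (f i), forall e : {set G}, ~~ (e \subset S)}]) /\
    (forall i j, i < j < l -> sverts (f j) :&: sverts (f i) \subset S).
  exists f; split=> [i|i j]; first by case: (goodf i (ltn_ord i)).
  wlog lt_ij : i j / i < j => [wl neq_ij|_].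
    have [|le_ij] := ltnP i j; first by move/wl; apply.
    have neq_ji : j != i by rewrite eq_sym.
    have [|e1 e2] := wl j i _ neq_ji; last by rewrite setIC e1 setIC.
    by rewrite ltn_neqAle neq_ji.
  have [[_ Si _] _ nSi] := goodf i (ltn_ord i).
  have [[_ Sj _] _ _] := goodf j (ltn_ord j).
  have subS : sverts (f j) :&: sverts (f i) \subset S.
    by apply: disjf; rewrite lt_ij /=.
  split; last by apply/eqP; rewrite eqEsubset setIC subS subsetI Sj Si.
  apply/setP => e; rewrite !inE; apply/negP => /andP[ei ej].
  (* A common edge would have both ends in [S]. *)
  have := nSi e ei; rewrite (subset_trans _ subS) // subsetI.
  by rewrite (sedges_verts ei) (sedges_verts ej).
suff grow m : m <= l -> exists f : nat -> subgraph G,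
    (forall i, i < m -> [/\ rainbow_Stree c S (f i), #|sverts (f i) :\: S| <= b &
       {in sedges (f i), forall e : {set G}, ~~ (e \subset S)}]) /\
    (forall i j, i < j < m -> sverts (f j) :&: sverts (f i) \subset S).
  exact: grow.
elim: m => [|m IH] le_m.
  (* This tree is only a default value for the function [f]. *)
  have [||T _] := step set0; rewrite ?cards0 //.
    by rewrite -setI_eq0 set0I.
  by exists (fun=> T); split=> // i j; rewrite ltn0 andbF.
have [f [goodf disjf]] := IH (ltnW le_m).
pose F := \bigcup_(i < m) (sverts (f i) :\: S).
have [||T [rT bT dT nT]] := step F.
- rewrite -setI_eq0; apply/eqP/setP => x; rewrite !inE.
  by apply/negP => /andP[/bigcupP[i _]]; rewrite inE => /andP[/negPf->].
- apply: leq_trans (card_big_setU _ _ _) _.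
  apply: (@leq_trans (\sum_(i < m) b)).
    by apply: leq_sum => i _; case: (goodf i (ltn_ord i)).
  by rewrite sum_nat_const card_ord mulnC leq_mul // ltnW.
exists (fun i => if i == m then T else f i); split=> [i|i j].
  by rewrite ltnS leq_eqVlt; case: eqP => //= _; apply: goodf.
rewrite ltnS => /andP[lt_ij le_jm].
have lt_im : i < m by apply: leq_trans le_jm.
rewrite (ltn_eqF lt_im); case: ltngtP le_jm => // [lt_jm _|_ _].
  by apply: disjf; rewrite lt_ij.
apply/subsetP => x; rewrite inE => /andP[xT xf]; apply: contraTT xT => xS.
rewrite (disjointFl dT) //; apply/bigcupP; exists (Ordinal lt_im) => //.
by rewrite inE xS.
Qed.

(** * Families of trees in complete multipartite graphs *)

Definition part (r : nat) (n : r.-tuple nat) (i : 'I_r) :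
    {set complete_multipartite n} := [set u | tag u == i].

(** Labels below [#|S|] keep the last color free for the central edge of a double star when
    [#|S| <= t]. *)
Lemma injective_labels (T : finType) (S : {set T}) (t : nat) :
  #|S| <= t.+1 ->
  exists h : T -> 'I_t.+1, {in S &, injective h} /\
    {in S, forall x, h x < #|S|}.
Proof.
move=> cS; exists (fun x => inord (index x (enum S))).
have lt_i x : x \in S -> index x (enum S) < #|S|.
  by move=> xS; rewrite cardE index_mem mem_enum.
split=> [x y xS yS /(congr1 val)|x xS]; last first.
  by rewrite inordK ?lt_i // (leq_trans (lt_i x xS)).
rewrite /= !inordK ?(leq_trans (lt_i _ _)) //.
by move=> /(congr1 (nth x (enum S))); rewrite !nth_index ?mem_enum.
Qed.

(** All of [S] is adjacent to class [i], and [F] has at most [l] vertices. The shift [(c e).+1]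
    turns colors counted from 0 into colors counted from 1. *)
Lemma star_family (r : nat) (n : r.-tuple nat) (q t l : nat)
    (c : {set complete_multipartite n} -> 'I_t.+1)
    (S : {set complete_multipartite n}) (i : 'I_r) :
  extensible q (part n) c -> #|S| + l <= q -> #|S| <= t.+1 ->
  [disjoint S & part n i] ->
  exists T : 'I_l -> subgraph (complete_multipartite n),
    (forall j, rainbow_Stree (fun e => (c e).+1) S (T j)) /\
    internally_disjoint S T.
Proof.
move=> ext le_q le_t Si; apply: (@disjoint_family _ _ _ 1) => F FS cF.
have [h [injh _]] := injective_labels le_t.
have [|w [wi wA wh]] := ext (S :|: F) h i.
  by apply: leq_trans (leq_card_setU _ _) _; lia.
move: wA; rewrite inE negb_or => /andP[wS wF].
have [||T [rT vT nT]] := @star_rainbow _ (fun e => (c e).+1) S w wS.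
- move=> s sS; rewrite /= /multipartite_adj /=.
  have := disjointFr Si sS; rewrite inE in wi; rewrite inE (eqP wi) => /negbT.
  by rewrite eq_sym.
- move=> x y xS yS [/val_inj]; rewrite !wh ?inE ?xS ?yS //; exact: injh.
exists T; split=> //; rewrite vT.
  by rewrite setDUl setDv setU0 (leq_trans (subset_leq_card (subsetDl _ _))) ?cards1.
rewrite disjoint_subset; apply/subsetP => x; rewrite !inE.
by case/orP => [/eqP-> // | xS]; rewrite (disjointFl FS).
Qed.

(** Classes 0 and 1 supply [u] and [v] for every [S]: a vertex not adjacent to [u] lies in class 0,
    hence is adjacent to [v]. The strict bound by [q] leaves room for [u] in the pattern of [v]. *)
Lemma double_star_family (r : nat) (n : r.-tuple nat) (q t l : nat)
    (c : {set complete_multipartite n} -> 'I_t.+1)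
    (S : {set complete_multipartite n}) :
  1 < r -> extensible q (part n) c -> #|S| + 2 * l < q -> #|S| <= t ->
  exists T : 'I_l -> subgraph (complete_multipartite n),
    (forall j, rainbow_Stree (fun e => (c e).+1) S (T j)) /\
    internally_disjoint S T.
Proof.
move=> r1 ext le_q le_t; apply: (@disjoint_family _ _ _ 2) => F FS cF.
pose i := Ordinal (ltnW r1); pose i' := Ordinal r1.
have [h [injh lth]] := injective_labels (leqW le_t).
have cSF : #|S :|: F| <= #|S| + #|F| by apply: leq_card_setU.
have [|u [ui uA uh]] := ext (S :|: F) h i; first by lia.
(* The edge between the centers gets the color [ord_max], which labels no vertex of [S]. *)
have [|v [vi' vA vh]] := ext (u |: (S :|: F)) (fun x => if x == u then ord_max else h x) i'.
  by rewrite cardsU1; case: (_ \notin _); lia.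
move: uA vA; rewrite !inE !negb_or => /andP[uS uF] /and3P[vu vS vF].
rewrite !inE in ui vi'.
have adjE x y : @adj (complete_multipartite n) x y = (tag x != tag y) by [].
have chi s : s \in S ->
    c [set (if @adj (complete_multipartite n) u s then u else v); s] = h s.
  move=> sS; case: ifP => _; first by rewrite uh // inE sS.
  by rewrite vh ?inE ?sS ?orbT //; case: eqP sS uS => // -> ->.
have cuv : c [set u; v] = ord_max by rewrite setUC vh ?inE ?eqxx.
have [||||T [rT vT nT]] :=
  @double_star_rainbow _ (fun e => (c e).+1) S u v uS vS.
- by rewrite adjE (eqP ui) (eqP vi').
- move=> s sS; rewrite !adjE negbK => /eqP <-.
  by rewrite (eqP ui) (eqP vi').
- by move=> x y xS yS [/val_inj]; rewrite !chi //; apply: injh.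
- move=> s sS []; rewrite chi // cuv /= => eq_t.
  by have := lth s sS; rewrite eq_t ltnNge le_t.
exists T; split=> //; rewrite vT.
  apply: leq_trans (_ : #|[set u; v]| <= _); last by rewrite cards2; case: (_ != _).
  by apply/subset_leq_card/subsetP => x; rewrite !inE; case: (x \in S); rewrite ?orbF.
rewrite disjoint_subset; apply/subsetP => x; rewrite !inE.
by case/or3P => [/eqP->|/eqP->|xS] //; rewrite (disjointFl FS).
Qed.

(** These trees use edges inside [S], so the greedy lemma does not apply; instead each tree receives
    its own edge of the triangle spanned by [S]. *)
Lemma triangle_family (n : 3.-tuple nat) (q : nat)
    (c : {set complete_multipartite n} -> 'I_3)
    (S : {set complete_multipartite n}) :
  extensible q (part n) c -> #|S| = 3 -> 3 <= q ->
  (forall i, ~~ [disjoint S & part n i]) ->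
  exists T : 'I_3 -> subgraph (complete_multipartite n),
    (forall j, rainbow_Stree (fun e => (c e).+1) S (T j)) /\
    internally_disjoint S T.
Proof.
move=> ext cS q3 meet; pose G := complete_multipartite n.
have [s sS] : exists s : 'I_3 -> G, forall i, s i \in S /\ tag (s i) = i.
  apply: (@fin_all_exists _ (fun=> G) (fun i x => x \in S /\ tag x = i)) => i.
  have := meet i; rewrite -setI_eq0 => /set0Pn[x].
  by rewrite !inE => /andP[xS /eqP xi]; exists x.
have sinS i : s i \in S by case: (sS i).
have tags i : tag (s i) = i by case: (sS i).
(* Three vertices meeting three classes: exactly one in each. *)
have Ss x : x \in S -> s (tag x) = x.
  have imS : s @: setT = S.
    apply/eqP; rewrite eqEcard cS card_imset ?cardsT ?card_ord ?andbT.
      by apply/subsetP => _ /imsetP[i _ ->].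
    by move=> i j eq_s; rewrite -(tags i) eq_s tags.
  by rewrite -{1}imS => /imsetP[i _ ->]; rewrite tags.
(* Indices live in Z/3; the tree at w i gives the edge below s j the color
   g i + (j - i), where s i hangs from s (i + 1) and the others from w i. *)
pose g i := c [set s i; s (i + 1)%R].
have [w W] : exists w : 'I_3 -> G, forall i, [/\ tag (w i) = i, w i \notin S &
    {in S, forall x, c [set w i; x] = (g i + (tag x - i))%R}].
  apply: (@fin_all_exists _ (fun=> G) (fun i w => [/\ tag w = i, w \notin S &
    {in S, forall x, c [set w; x] = (g i + (tag x - i))%R}])) => i.
  have [|w [wi wS wh]] := ext S (fun x => g i + (tag x - i))%R i; first by rewrite cS.
  by exists w; split=> //; move: wi; rewrite inE => /eqP.
pose p i (x : G) := if x == s i then s (i + 1)%R else w i.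
have S_w i : (w i |: S) :\ w i = S by rewrite setU1K //; case: (W i).
have succ_neq (i : 'I_3) : (i + 1 != i)%R by rewrite -subr_eq0 addrAC subrr.
have treeP i : exists T : subgraph G, [/\ rainbow_Stree (fun e => (c e).+1) S T,
    sverts T = w i |: S & sedges T = [set [set v; p i v] | v in S]].
  have [wi wS wh] := W i.
  have sw j : (s j == w i) = false by apply: contraNF wS => /eqP <-.
  suff [T [rT vT eT]] : exists T : subgraph G,
      [/\ rainbow_Stree (fun e => (c e).+1) S T, sverts T = w i |: S &
         sedges T = [set [set v; p i v] | v in (w i |: S) :\ w i]].
    by exists T; split; rewrite // eT S_w.
  (* Depth 0 at [w i], 2 at [s i] and 1 at the other two vertices. *)
  apply: (@rooted_rainbow _ _ _ _ _ _
    (fun x => (x != w i) + (x == s i))); rewrite ?S_w.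
  - exact: setU11.
  - exact: subsetUr.
  - move=> v; rewrite !inE => /orP[->//|vS] vw; rewrite /p.
    case: (eqVneq v (s i)) => [->|vsi]; rewrite ?eqxx.
      rewrite sinS orbT !sw /= /multipartite_adj /= !tags eq_sym succ_neq.
      split=> //; case: eqP => // /(congr1 tag); rewrite !tags => /eqP.
      by rewrite (negPf (succ_neq i)).
    rewrite [w i == _]eq_sym sw vw; split=> //.
    rewrite /= /multipartite_adj /= wi; apply: contra vsi => /eqP vi.
    by rewrite -(Ss v vS) vi.
  - have col v : v \in S -> c [set v; p i v] = (g i + (tag v - i))%R.
      move=> vS; rewrite /p; case: eqP => [->|_]; last by rewrite setUC wh.
      by rewrite tags subrr addr0.
    move=> x y xS yS [/val_inj]; rewrite !col // => /addrI /addIr eq_xy.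
    by rewrite -(Ss x xS) eq_xy Ss.
have [T TP] := @fin_all_exists _ (fun=> subgraph G) _ treeP.
exists T; split=> [i|i j neq_ij]; first by case: (TP i).
have [_ Vi Ei] := TP i; have [_ Vj Ej] := TP j.
have [wi wiS _] := W i; have [wj wjS _] := W j.
have wij : w i != w j by apply: contra neq_ij => /eqP e; rewrite -wi e wj.
split; last first.
  apply/setP => x; rewrite Vi Vj !inE; case: (x \in S); rewrite ?orbT // !orbF.
  by apply/negP => /andP[/eqP-> ]; apply/negP.
apply/setP => e; rewrite in_set0 inE; apply/negP => /andP[ei ej].
have := sedges_verts ej; have := sedges_verts ei.
move: ei ej; rewrite Vi Vj Ei Ej => /imsetP[x xS ->] /imsetP[y yS].
rewrite /p; case: eqP => [->|_]; last first.
  move=> _ _; rewrite subUset !sub1set => /andP[_].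
  by rewrite !inE (negPf wij) (negPf wiS).
case: eqP => [-> |_ ->]; last first.
  rewrite subUset !sub1set => /andP[_]; rewrite !inE eq_sym (negPf wij).
  by rewrite (negPf wjS).
(* Only edges inside [S] can coincide. Matching their ends straight gives i = j, and crosswise 1 + 1
   = 0 in Z/3. *)
case/eq_set2_cases => -[/(congr1 tag) + /(congr1 tag)]; rewrite !tags.
  by move=> eij; rewrite eij eqxx in neq_ij.
by move=> -> /eqP; rewrite -subr_eq0 addrAC [(j + 1 - j)%R]addrAC subrr.
Qed.

(** * Lower bounds on the number of colors *)

Lemma rainbow_size (G : sgraph) (t : nat) (c : {set G} -> nat) (S : {set G})
    (T : subgraph G) :
  edge_coloring t c -> rainbow_Stree c S T -> #|sedges T| <= t.
Proof.
move=> colc [_ _ inj]; rewrite cardE -(size_map c) -[leqRHS](size_iota 1).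
apply: uniq_leq_size.
  rewrite map_inj_in_uniq ?enum_uniq // => x y; rewrite !mem_enum; exact: inj.
move=> _ /mapP[e + ->]; rewrite mem_enum => eT; rewrite mem_iota add1n ltnS.
by apply: colc; apply: (subsetP (sedges_sub T)).
Qed.

Lemma rainbow_order (G : sgraph) (t : nat) (c : {set G} -> nat) (S : {set G})
    (T : subgraph G) :
  edge_coloring t c -> rainbow_Stree c S T -> #|sverts T| <= t.+1.
Proof.
move=> colc rT; have [[conn _] _ _] := rT.
by apply: leq_trans (connected_card conn) _; rewrite ltnS (rainbow_size colc rT).
Qed.

Lemma edgesP (G : sgraph) (e : {set G}) :
  e \in edges G -> exists u v, adj u v /\ e = [set u; v].
Proof. by case/imset2P => u v _ /= uv ->; exists u, v. Qed.

Section LowerBounds.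

Variables (r : nat) (n : r.-tuple nat).
Local Notation G := (complete_multipartite n).

(** Supplies both extremal sets: [S] inside one class, and [S] spread evenly. *)
Lemma exists_profile (s : 'I_r -> nat) :
  (forall i, s i <= tnth n i) ->
  exists S : {set G}, #|S| = \sum_i s i /\ forall i, #|S :&: part n i| = s i.
Proof.
move=> le_s; exists [set u : G | tagged u < s (tag u)].
set S := [set u | _].
have cS i : #|S :&: part n i| = s i.
  have -> : S :&: part n i =
      Tagged (fun i : 'I_r => 'I_(tnth n i)) @: [set j : 'I_(tnth n i) | j < s i].
    apply/setP => -[i' j]; rewrite !inE /=; apply/andP/imsetP => [[lt_j /eqP e]|].
      by subst i'; exists j; rewrite ?inE.
    by case=> j'; rewrite inE => lt_j /= e; move: (congr1 tag e) => /= e'; subst i';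
      rewrite (eq_from_Tagged e) eqxx.
  rewrite card_imset; last by move=> x y; apply: eq_from_Tagged.
  by rewrite -sum1dep_card (big_ord_narrow (le_s i)) sum_nat_const card_ord muln1.
split=> //; rewrite -sum1_card (partition_big (fun u : G => tag u) predT) //=.
by apply: eq_bigr => i _; rewrite -cS -sum1_card; apply: eq_bigl => u; rewrite !inE.
Qed.

(** With fewer than [#|S|] colors the tree has no vertex outside [S], yet it needs an edge and a
    class contains none. *)
Lemma independent_lower (S : {set G}) (i : 'I_r) (t : nat) (c : {set G} -> nat)
    (T : subgraph G) :
  S \subset part n i -> 1 < #|S| ->
  edge_coloring t c -> rainbow_Stree c S T -> #|S| <= t.
Proof.
move=> Si S1 colc rT; rewrite leqNgt; apply/negP => lt_t.
have [[conn _] ST _] := rT.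
have VS : sverts T = S.
  apply/esym/eqP; rewrite eqEcard ST /=.
  by apply: leq_trans (rainbow_order colc rT) _.
have /card_gt0P[e eT] : 0 < #|sedges T|.
  by rewrite -ltnS; apply: leq_trans (connected_card conn); rewrite VS.
have [u [v [uv def_e]]] := edgesP (subsetP (sedges_sub T) e eT).
have := sedges_verts eT; rewrite VS def_e subUset !sub1set => /andP[uS vS].
move: uv (subsetP Si u uS) (subsetP Si v vS); rewrite !inE /= /multipartite_adj /=.
by move=> uv /eqP eu /eqP ev; rewrite eu ev eqxx in uv.
Qed.

(** A tree inside [S] has at least [#|S| - 1 >= m] edges. Otherwise it has one further vertex [w]
    and at least [#|S|] edges, of which at most [#|S| - m] meet [w]. *)
Lemma few_colors_inner_edges (S : {set G}) (m : nat) (T : subgraph G) :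
  connected T -> S \subset sverts T -> #|sedges T| <= #|S| -> m < #|S| ->
  (forall i, m <= #|S :&: part n i|) ->
  m <= #|[set e in sedges T | e \subset S]|.
Proof.
move=> conn ST le_E lt_m le_m; have le_V := connected_card conn.
have [VS|/subsetPn[w wV wS]] := boolP (sverts T \subset S).
  have -> : [set e in sedges T | e \subset S] = sedges T.
    apply/setP => e; rewrite inE; apply: andb_idr => eT.
    by apply: subset_trans VS; apply: sedges_verts.
  by rewrite -ltnS; apply: leq_trans le_V; apply: leq_trans lt_m (subset_leq_card ST).
have VwS : sverts T = w |: S.
  apply/esym/eqP; rewrite eqEcard subUset sub1set wV ST /= cardsU1 wS.
  by apply: leq_trans le_V _.
have cE : #|S| <= #|sedges T| by rewrite VwS cardsU1 wS in le_V.
pose N := S :\: part n (tag w).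
(* Edges at [w] end in [S] outside the class of [w]. *)
have sub : sedges T \subset
    [set e in sedges T | e \subset S] :|: [set [set w; s] | s in N].
  apply/subsetP => e eT; rewrite !inE eT /=; apply/orP.
  have [u [v [uv def_e]]] := edgesP (subsetP (sedges_sub T) e eT).
  have := sedges_verts eT; rewrite VwS def_e !subUset !sub1set !inE.
  move: uv; rewrite /= /multipartite_adj /= => uv.
  case/andP => /orP[/eqP eu|uS] /orP[/eqP ev|vS].
  - by rewrite eu ev eqxx in uv.
  - by right; apply/imsetP; exists v; rewrite ?eu // !inE vS -eu eq_sym uv.
  - by right; apply/imsetP; exists u; rewrite ?ev 1?setUC // !inE uS -ev uv.
  - by left; rewrite uS vS.
have cN : #|[set [set w; s] | s in N]| <= #|N| by apply: leq_imset_card.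
rewrite -(leq_add2r #|N|); apply: (@leq_trans #|S|).
  by rewrite -(cardsID (part n (tag w)) S) leq_add2r.
apply: leq_trans cE (leq_trans (subset_leq_card sub) _).
by apply: leq_trans (leq_card_setU _ _) _; rewrite leq_add2l.
Qed.

(** Edges are sorted by the pair of classes they join; each pair contributes at most [b ^ 2]. *)
Lemma inner_edges_upper (S : {set G}) (b : nat) :
  (forall i, #|S :&: part n i| <= b) ->
  #|[set e in edges G | e \subset S]| <= 'C(r, 2) * b ^ 2.
Proof.
move=> le_b; pose tags (e : {set G}) : {set 'I_r} := [set tag u | u in e].
pose E (P : {set 'I_r}) := [set e in edges G | (e \subset S) && (tags e == P)].
apply: (@leq_trans #|\bigcup_(P : {set 'I_r} | #|P| == 2) E P|).
  apply/subset_leq_card/subsetP => e; rewrite inE => /andP[eG eS].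
  apply/bigcupP; exists (tags e); last by rewrite inE eG eS eqxx.
  have [u [v [uv ->]]] := edgesP eG.
  by rewrite /tags imsetU1 imset_set1 cards2; rewrite /= /multipartite_adj /= in uv; rewrite uv.
apply: leq_trans (card_big_setU _ _ _) _.
apply: (@leq_trans (\sum_(P : {set 'I_r} | #|P| == 2) b ^ 2)); last first.
  by rewrite sum_nat_cond_const card_draws card_ord.
apply: leq_sum => P /cards2P[i [j [neq_ij ->]]].
apply: (@leq_trans #|[set [set u; v] | u in S :&: part n i, v in S :&: part n j]|).
  apply/subset_leq_card/subsetP => e; rewrite inE => /and3P[eG + /eqP].
  have [u [v [uv ->]]] := edgesP eG.
  rewrite subUset !sub1set /tags imsetU1 imset_set1 => /andP[uS vS].
  case/eq_set2_cases => -[ui vj]; apply/imset2P.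
    by exists u v; rewrite // !inE ?uS ?vS ?ui ?vj eqxx.
  by exists v u; rewrite 1?setUC // !inE ?uS ?vS ?ui ?vj eqxx.
rewrite curry_imset2X; apply: leq_trans (leq_imset_card _ _) _.
by rewrite cardsX -mulnn leq_mul.
Qed.

Lemma colorable_lower (k l t : nat) (i : 'I_r) :
  1 < k -> 0 < l -> k <= tnth n i -> rainbow_colorable k l G t -> k <= t.
Proof.
move=> k1 l0 le_k [c colc cov].
have [|S [cS cSi]] := @exists_profile (fun j => if j == i then k else 0).
  by move=> j; case: eqP => // ->.
have {}cS : #|S| = k.
  by rewrite cS (bigD1 i) //= eqxx big1 ?addn0 // => j /negPf->.
have [T [rT _]] := cov S cS; rewrite -cS.
apply: (independent_lower (i := i) _ _ colc (rT (Ordinal l0))); rewrite ?cS //.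
apply/setIidPl/eqP; rewrite eqEcard subsetIl cS cSi eqxx /=; exact: leqnn.
Qed.

(** The edges inside an evenly spread [S] are shared by [l] edge-disjoint trees, each taking at
    least floor(k/r). The term [k %/ r + (0 < k %% r)] is ceil(k/r). *)
Lemma balanced_lower (k l t : nat) :
  1 < r -> 1 < k -> (forall i, k <= tnth n i) -> t <= k ->
  rainbow_colorable k l G t ->
  l * (k %/ r) <= 'C(r, 2) * (k %/ r + (0 < k %% r)) ^ 2.
Proof.
move=> r1 k1 le_k le_t [c colc cov].
have lt_kr : k %/ r < k by apply: ltn_Pdiv => //; apply: ltnW.
(* The remainder [k %% r] is spread over the first classes, one vertex each. *)
have [|S [cS cSi]] := @exists_profile (fun i => k %/ r + (i < k %% r)).
  by move=> i; apply: leq_trans (le_k i); case: (_ < _); lia.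
have {}cS : #|S| = k.
  rewrite cS big_split /= sum_nat_const card_ord [RHS](divn_eq k r) mulnC.
  congr (_ + _); rewrite -big_mkcond /=.
  rewrite (big_ord_narrow (ltnW (ltn_pmod k (ltnW r1)))).
  by rewrite sum_nat_const card_ord muln1.
have [T [rT disT]] := cov S cS.
pose I j := [set e in sedges (T j) | e \subset S].
have disI j j' : j != j' -> [disjoint I j & I j'].
  move=> /disT[/setP dis _]; rewrite -setI_eq0; apply/eqP/setP => e.
  have := dis e; rewrite !inE; case: (e \in sedges (T j)) => //=.
  by case: (e \in sedges (T j')) => //=; rewrite andbF.
have big_I j : k %/ r <= #|I j|.
  have [[conn _] ST _] := rT j; apply: few_colors_inner_edges => //; rewrite ?cS //.
    exact: leq_trans (rainbow_size colc (rT j)) le_t.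
  by move=> i; rewrite cSi leq_addr.
apply: leq_trans (@inner_edges_upper S (k %/ r + (0 < k %% r)) _); last first.
  by move=> i; rewrite cSi leq_add2l; case: (k %% r) => [|m]; rewrite ?ltn0 // leq_b1.
apply: (@leq_trans #|\bigcup_j I j|).
  rewrite -sum1_card partition_disjoint_bigcup //.
  rewrite -[X in X * _]card_ord -sum_nat_const.
  by apply: leq_sum => j _; rewrite sum1_card.
apply/subset_leq_card/bigcupsP => j _; apply/subsetP => e; rewrite !inE.
by case/andP => /(subsetP (sedges_sub _)) -> ->.
Qed.

End LowerBounds.

(** * Extensible colorings for polynomially related class sizes *)

Lemma card_part (r : nat) (n : r.-tuple nat) (i : 'I_r) :
  #|part n i| = tnth n i.
Proof.
have -> : part n i =
    Tagged (fun i : 'I_r => 'I_(tnth n i)) @: [set: 'I_(tnth n i)].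
  apply/setP => -[i' j]; rewrite inE /=; apply/eqP/imsetP => [e|[j' _ e]].
    by subst i'; exists j; rewrite ?inE.
  exact: (congr1 (fun u : complete_multipartite n => tag u) e).
by rewrite card_imset ?cardsT ?card_ord // => x y; apply: eq_from_Tagged.
Qed.

Lemma card_complete_multipartite (r : nat) (n : r.-tuple nat) :
  #|complete_multipartite n| = \sum_(i < r) tnth n i.
Proof.
rewrite -sum1_card.
rewrite (partition_big (fun u : complete_multipartite n => tag u) predT) //=.
apply: eq_bigr => i _; rewrite -card_part -sum1_card.
by apply: eq_bigl => u; rewrite inE.
Qed.

Lemma eventually_extensible (t q r K a : nat) :
  exists N, forall (n : r.-tuple nat) (m : nat), N <= m ->
    (forall i, m <= tnth n i <= K * m ^ a) ->
    exists c : {set complete_multipartite n} -> 'I_t.+1,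
      extensible q (part n) c.
Proof.
have [N extN] := extension_coloring t q r (r * K) a.
exists N => n m le_Nm bounds; apply: extN le_Nm _ _ => [i|].
  by rewrite card_part; case/andP: (bounds i).
rewrite card_complete_multipartite -mulnA -[X in X * _]card_ord -sum_nat_const.
by apply: leq_sum => i _; case/andP: (bounds i).
Qed.

(** * Upper bounds on the number of colors *)

Section UpperBounds.

Variables (r : nat) (n : r.-tuple nat).
Local Notation G := (complete_multipartite n).

Lemma coloring_succ (t : nat) (c : {set G} -> 'I_t.+1) :
  edge_coloring t.+1 (fun e => (c e).+1).
Proof. by move=> e _; rewrite /= ltn_ord. Qed.

(** Fewer vertices than classes leave a class free for the centers of stars. The set size is [k.+1],
    matching the palette ['I_k.+1]. *)
Lemma colorable_missed_part (k l : nat) (c : {set G} -> 'I_k.+1) :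
  k.+1 < r -> extensible (k.+1 + l) (part n) c ->
  rainbow_colorable k.+1 l G k.+1.
Proof.
move=> lt_kr ext; exists (fun e => (c e).+1); first exact: coloring_succ.
move=> S cS; have [i Si] : exists i, [disjoint S & part n i].
  have [/existsP//|] := boolP [exists i, [disjoint S & part n i]].
  rewrite negb_exists => /forallP meet.
  have : #|'I_r| <= #|[set tag u | u in S]|.
    rewrite -cardsT; apply/subset_leq_card/subsetP => i _.
    have := meet i; rewrite -setI_eq0 => /set0Pn[u]; rewrite !inE.
    by case/andP=> uS /eqP <-; apply: imset_f.
  by rewrite card_ord => /leq_trans/(_ (leq_imset_card _ _)); rewrite cS leqNgt lt_kr.
by apply: star_family ext _ _ Si; rewrite cS.
Qed.

Lemma colorable_succ (k l : nat) (c : {set G} -> 'I_k.+1) :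
  1 < r -> extensible (k + 2 * l).+1 (part n) c ->
  rainbow_colorable k l G k.+1.
Proof.
move=> r1 ext; exists (fun e => (c e).+1); first exact: coloring_succ.
by move=> S cS; apply: double_star_family r1 ext _ _; rewrite cS.
Qed.

End UpperBounds.

(** Stars serve if [S] misses a class; otherwise [l] of the three triangle trees are taken. *)
Lemma colorable_triangle (n : 3.-tuple nat) (l : nat)
    (c : {set complete_multipartite n} -> 'I_3) :
  l <= 3 -> extensible (3 + l) (part n) c ->
  rainbow_colorable 3 l (complete_multipartite n) 3.
Proof.
move=> l3 ext; exists (fun e => (c e).+1); first exact: coloring_succ.
move=> S cS; have [/existsP[i Si]|] := boolP [exists i, [disjoint S & part n i]].
  by apply: star_family ext _ _ Si; rewrite cS.
rewrite negb_exists => /forallP meet.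
have [T [rT dT]] := triangle_family ext cS (leq_addr _ _) meet.
by exists (fun i => T (widen_ord l3 i)); split=> // i j neq_ij; apply: dT.
Qed.

(** * Translation of the numerical hypotheses *)

Lemma sorted_bounds (r : nat) (n : r.-tuple nat) (i : 'I_r) :
  sorted leq n -> head 0 n <= tnth n i <= last 0 n.
Proof.
move=> sort_n; rewrite -nth0 -nth_last (tnth_nth 0) size_tuple.
have homo := sorted_leq_nth leq_trans leqnn 0 sort_n.
have lt_ir := ltn_ord i.
by apply/andP; split; apply: homo; rewrite ?inE ?size_tuple //; lia.
Qed.

(** The floor is computed exactly; for the ceiling, which sits in the numerator, a lower bound
    suffices. *)
Lemma threshold_nat (k l r : nat) : 0 < r -> r <= k ->
  l * (k %/ r) <= 'C(r, 2) * (k %/ r + (0 < k %% r)) ^ 2 ->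
  (l%:R <= rx_threshold k r)%R.
Proof.
move=> r0 le_rk le_l; rewrite /rx_threshold.
have r0Q : (0 < r%:R :> rat)%R by rewrite ltr0n.
have def_k : (k%:R = (k %/ r)%:R * r%:R + (k %% r)%:R :> rat)%R.
  by rewrite {1}(divn_eq k r) natrD natrM.
have -> : Num.floor (k%:R / r%:R : rat)%R = Posz (k %/ r).
  apply: floor_def; rewrite ler_pdivlMr // ltr_pdivrMr //.
  rewrite def_k -!pmulrn -!natrM -!natrD ler_nat ltr_nat.
  by have := ltn_pmod k r0; nia.
have le_ceil : (Posz (k %/ r + (0 < k %% r))%N <= Num.ceil (k%:R / r%:R : rat))%R.
  case: (posnP (k %% r)) => [e|k0].
    rewrite -(ler_int rat); apply: le_trans (ceil_ge _).
    by rewrite ler_pdivlMr // def_k e -!pmulrn addn0 addr0.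
  rewrite PoszD lezD1 ceil_gt_int ltr_pdivlMr // def_k.
  by rewrite -pmulrn ltrDl ltr0n.
have f0 : (0 < (Posz (k %/ r))%:~R :> rat)%R by rewrite -pmulrn ltr0n divn_gt0.
rewrite ler_pdivlMr // -pmulrn -natrM.
apply: (@le_trans _ _ ('C(r, 2) * (k %/ r + (0 < k %% r)) ^ 2)%:R%R).
  by rewrite ler_nat.
rewrite natrM natrX ler_wpM2l ?ler0n // lerXn2r ?nnegrE ?ler0n //.
  by rewrite ler0z; apply: le_trans le_ceil.
by rewrite [X in (X <= _)%R]pmulrn ler_int.
Qed.

(** Both constants are rounded up to naturals; raising the exponent is harmless because the base [m]
    is at least 1. *)
Lemma polynomial_bound (R : realType) (alpha C : R) : (0 <= alpha)%R -> (0 < C)%R ->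
  exists K a : nat, forall m M : nat, 0 < m ->
    (M%:R <= C * m%:R `^ alpha)%R -> M <= K * m ^ a.
Proof.
move=> alpha0 C0; exists (Num.bound C), (Num.bound alpha) => m M m0 le_M.
rewrite -(ler_nat R) natrM natrX; apply: le_trans le_M _.
apply: ler_pM; rewrite ?powR_ge0 ?(ltW C0) //.
  by rewrite ltW // archi_boundP // ltW.
rewrite -powR_mulrn ?ler0n //; apply: ler_powR; first by rewrite ler1n.
by rewrite ltW // archi_boundP.
Qed.

(** * Comparison of the bounds for large classes *)

Local Open Scope ring_scope.

Theorem theorem3p4 (R : realType) (alpha C : R) :
  1 <= alpha -> 0 < C ->
  (forall k l r : nat, (0 < l)%N -> (3 <= k)%N -> (3 <= r)%N ->
    exists2 N : nat, (0 < N)%N &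
    forall n : r.-tuple nat,
      all (leq 1) n -> sorted leq n ->
      (last 0%N n)%:R <= C * (head 0%N n)%:R `^ alpha ->
      (N <= head 0%N n)%N ->
      [/\ ((k < r)%N ->
             is_rx k l (complete_multipartite n) k),
          ((r <= k)%N -> l%:R <= rx_threshold k r ->
             is_rx k l (complete_multipartite n) k
             \/ is_rx k l (complete_multipartite n) k.+1) &
          ((r <= k)%N -> rx_threshold k r < l%:R ->
             is_rx k l (complete_multipartite n) k.+1)])
  /\
  (forall l : nat, (0 < l)%N -> (l <= 3)%N ->
    exists2 N : nat, (0 < N)%N &
    forall n1 n2 n3 : nat,
      (0 < n1)%N -> (n1 <= n2)%N -> (n2 <= n3)%N ->
      n3%:R <= C * n1%:R `^ alpha ->
      (N <= n1)%N ->
      is_rx 3 l (complete_multipartite [tuple n1; n2; n3]) 3).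
Proof.
move=> alpha1 C0.
have [K [a poly]] := polynomial_bound (le_trans ler01 alpha1) C0.
have bounds r (n : r.-tuple nat) : sorted leq n -> (0 < head 0%N n)%N ->
    (last 0%N n)%:R <= C * (head 0%N n)%:R `^ alpha ->
    forall i, (head 0%N n <= tnth n i <= K * head 0%N n ^ a)%N.
  move=> sort_n n0 /(poly _ _ n0) le_last i.
  by have /andP[-> /leq_trans->] := sorted_bounds i sort_n.
split=> [[//|k] l r l0 k3 r3 | l l0 l3].
  have r1 : (1 < r)%N by apply: ltnW.
  (* With [k.+1] in the role of k, [N1] serves colorings with k colors and [N2] those with k + 1. *)
  have [N1 ext1] := eventually_extensible k (k.+1 + l) r K a.
  have [N2 ext2] := eventually_extensible k.+1 (k.+1 + 2 * l).+1 r K a.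
  (* The term [k.+1] lets every class contain a whole set [S], as the lower bounds require. *)
  exists (maxn (maxn N1 N2) k.+1) => [|n _ sort_n le_last].
    by rewrite leq_max orbT.
  rewrite !geq_max -andbA => /and3P[le_N1 le_N2 le_k].
  have bnd := bounds r n sort_n (leq_trans (ltn0Sn k) le_k) le_last.
  have le_kn i : (k.+1 <= tnth n i)%N.
    by case/andP: (bnd i) => + _; apply: leq_trans.
  have [c1 /colorable_missed_part up1] := ext1 n _ le_N1 bnd.
  have [c2 /(colorable_succ r1) up2] := ext2 n _ le_N2 bnd.
  have low t : rainbow_colorable k.+1 l (complete_multipartite n) t -> (k < t)%N.
    exact: (colorable_lower (ltnW k3) l0 (le_kn (Ordinal r1))).
  have rx_succ : ~ rainbow_colorable k.+1 l (complete_multipartite n) k.+1 ->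
      is_rx k.+1 l (complete_multipartite n) k.+2.
    move=> not_k; split=> // t col_t; rewrite ltn_neqAle low // andbT.
    by apply/eqP => def_t; apply: not_k; rewrite {2}def_t.
  split=> [lt_kr | le_rk _ | le_rk lt_l].
  - by split=> //; apply: up1.
  (* Classical case distinction on whether k colors suffice. *)
  - by have [col|/rx_succ] := pselect (rainbow_colorable k.+1 l (complete_multipartite n) k.+1);
      [left | right].
  (* If k colors sufficed, the count inside a balanced [S] would put [l] below the threshold. *)
  - apply: rx_succ => col; move: lt_l; rewrite ltNge threshold_nat //.
      exact: ltnW.
    exact: (balanced_lower r1 (ltnW k3) le_kn (leqnn _) col).
have [N ext] := eventually_extensible 2 (3 + l) 3 K a.
exists (maxn N 3) => [|n1 n2 n3 n0 le12 le23 le3]; first by rewrite leq_max orbT.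
rewrite geq_max => /andP[le_N le_3].
have bnd := bounds 3%N [tuple n1; n2; n3].
rewrite /= le12 le23 in bnd.
have {}bnd := bnd isT n0 le3.
have [c /(colorable_triangle l3) up] := ext _ _ le_N bnd.
split=> // t; apply: (colorable_lower (i := ord0)) => //.
Qed.
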